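(* Let $n\ge 5$ and let $\Sigma$ be a bipyramid on $n$ vertices. Then every generic framework $(\Sigma,\mathbf p)$ in $\mathbb R^2$ admits at most $n-4$ congruence classes, i.e. the set of configurations $\mathbf q\in(\mathbb R^2)^n$ such that $(\Sigma,\mathbf q)$ is equivalent to $(\Sigma,\mathbf p)$ splits into at most $n-4$ classes under congruence.
   Context: For a configuration $\mathbf p=(\mathbf p(1),\dots,\mathbf p(n))\in(\mathbb R^2)^n$ and a triple $\sigma=i_1i_2i_3$ with $1\le i_1<i_2<i_3\le n$, let $C(\sigma,\mathbf p)$ be the $3\times 3$ matrix whose $k$-th column is $(1,\mathbf p(i_k))^T$. A framework $(\Sigma,\mathbf p)$ is a pure 2-dimensional simplicial complex $\Sigma$ on vertex set $\{1,\dots,n\}$ together with a configuration $\mathbf p\in(\mathbb R^2)^n$. Two frameworks $(\Sigma,\mathbf p)$, $(\Sigma,\mathbf q)$ are equivalent if $\det C(\sigma,\mathbf p)=\det C(\sigma,\mathbf q)$ for every 2-simplex $\sigma$ of $\Sigma$ (signed areas), and congruent if $\det C(\sigma,\mathbf p)=\det C(\sigma,\mathbf q)$ for every triple $\sigma\subseteq\{1,\dots,n\}$. The congruence classes of $(\Sigma,\mathbf p)$ are the equivalence classes, under congruence, of the set of configurations $\mathbf q$ with $(\Sigma,\mathbf q)$ equivalent to $(\Sigma,\mathbf p)$. A framework is generic if the $2n$ coordinates of $\mathbf p$ are algebraically independent over $\mathbb Q$. The bipyramid on $n$ vertices, $B_{n-2}$, is the pure 2-dimensional simplicial complex on $\{1,\dots,n\}$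 whose 2-simplices are $\{1,i,i+1\}$ and $\{i,i+1,n\}$ for $2\le i\le n-2$, together with $\{1,2,n-1\}$ and $\{2,n-1,n\}$. *)

(* Defs.v *)
From HB Require Import structures.
From mathcomp Require Import all_boot all_order all_algebra.
From mathcomp Require Import boolp classical_sets functions cardinality reals.
From mathcomp Require Import mpoly zify.

Set Implicit Arguments.
Unset Strict Implicit.
Unset Printing Implicit Defensive.

Import Order.TTheory GRing.Theory Num.Theory.
Local Open Scope ring_scope.

(* The vertex labelled v in {1, ..., n} is the ordinal of value v - 1. *)
Record pure2_complex (n : nat) := Pure2Complex {
  faces : {set {set 'I_n}};
  faces_down : forall s t : {set 'I_n},
    s \in faces -> t \subset s -> t \in faces;
  faces_vertex : forall v : 'I_n, [set v]%SET \in faces;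
  faces_pure : forall s : {set 'I_n}, s \in faces ->
    exists t : {set 'I_n}, [/\ t \in faces, s \subset t & #|t| = 3%N]
}.

Definition two_simplices (n : nat) (S : pure2_complex n) : {set {set 'I_n}} :=
  [set s in faces S | #|s| == 3%N]%SET.

Definition labelled (n : nat) (t : seq nat) : {set 'I_n} :=
  [set v : 'I_n | v.+1 \in t]%SET.

Definition bipyramid_triples (n : nat) : seq (seq nat) :=
  [seq [:: 1%N; i; i.+1] | i <- index_iota 2 n.-1]
  ++ [seq [:: i; i.+1; n] | i <- index_iota 2 n.-1]
  ++ [:: [:: 1%N; 2; n.-1]; [:: 2; n.-1; n]]%N.

Definition is_bipyramid (n : nat) (S : pure2_complex n) : Prop :=
  two_simplices S = [set:: [seq labelled n t | t <- bipyramid_triples n]]%SET.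

Lemma bipyramid_exists (n : nat) :
  (5 <= n)%N -> exists S : pure2_complex n, is_bipyramid S.
Proof.
move=> hn.
pose T := [set:: [seq labelled n t | t <- bipyramid_triples n]]%SET.
have lab3 a b c : (0 < a)%N -> (a < b)%N -> (b < c)%N -> (c <= n)%N ->
    #|labelled n [:: a; b; c]| = 3%N.
  move=> a0 ab bc cn.
  have ha : (a.-1 < n)%N by lia.
  have hb : (b.-1 < n)%N by lia.
  have hc : (c.-1 < n)%N by lia.
  have -> : labelled n [:: a; b; c]
      = [set Ordinal ha; Ordinal hb; Ordinal hc]%SET.
    by apply/setP => v; rewrite !inE -!val_eqE /=; lia.
  by rewrite -finset.setUA cardsU1 cards2 !inE -!val_eqE /=; lia.
have triples_mem (i : nat) : (2 <= i < n.-1)%N ->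
    labelled n [:: 1; i; i.+1]%N \in T /\ labelled n [:: i; i.+1; n] \in T.
  move=> hi; split; rewrite inE; apply: map_f; rewrite !mem_cat.
    by rewrite map_f // mem_index_iota.
  by rewrite orbC map_f // mem_index_iota.
have T3 t : t \in T -> #|t| = 3%N.
  rewrite inE => /mapP[u + ->]; rewrite !mem_cat => /or3P[/mapP[i]|/mapP[i]|].
  - by rewrite mem_index_iota => hi ->; apply: lab3; lia.
  - by rewrite mem_index_iota => hi ->; apply: lab3; lia.
  - by rewrite !inE => /orP[] /eqP ->; apply: lab3; lia.
have Tv (v : 'I_n) : exists2 t, t \in T & v \in t.
  have [v0|v0] := eqVneq (v : nat) 0%N.
    have [] := triples_mem 2%N; first by lia.
    by move=> h _; exists (labelled n [:: 1; 2; 3]%N) => //; rewrite !inE v0.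
  have [h|h] := leqP n.-2 v.
    exists (labelled n [:: 2; n.-1; n]%N).
      by rewrite inE; apply: map_f; rewrite !mem_cat !inE eqxx !orbT.
    by rewrite !inE; have := ltn_ord v; lia.
  have [] := triples_mem v.+1; first by lia.
  by move=> h' _; exists (labelled n [:: 1%N; v.+1; v.+2]) => //;
    rewrite !inE eqxx orbT.
pose F := [set s : {set 'I_n} | [exists t in T, s \subset t]]%SET.
have Fdown (s t : {set 'I_n}) : s \in F -> t \subset s -> t \in F.
  rewrite !inE => /exists_inP[u uT su] ts.
  by apply/exists_inP; exists u => //; apply: fintype.subset_trans su.
have Fv (v : 'I_n) : [set v]%SET \in F.
  by have [t tT vt] := Tv v; rewrite inE; apply/exists_inP; exists t;
    rewrite ?finset.sub1set.
have Fpure (s : {set 'I_n}) : s \in F ->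
    exists t : {set 'I_n}, [/\ t \in F, s \subset t & #|t| = 3%N].
  rewrite inE => /exists_inP[t tT st]; exists t; split => //; last exact: T3.
  by rewrite inE; apply/exists_inP; exists t.
exists (Pure2Complex Fdown Fv Fpure).
rewrite /is_bipyramid -/T; apply/setP => s; rewrite inE /=.
apply/andP/idP => [[]|sT]; last first.
  split; last by rewrite T3.
  by rewrite inE; apply/exists_inP; exists s.
rewrite inE => /exists_inP[t tT st] /eqP s3.
suff -> : s = t by [].
by apply/eqP; rewrite eqEcard st s3 T3.
Qed.

Section Frameworks.
Variables (R : realType) (n : nat).

(* Row i of a configuration is the point of the i-th vertex. *)
Definition configuration := 'M[R]_(n, 2).

Definition Cmat (i1 i2 i3 : 'I_n) (p : configuration) : 'M[R]_3 :=
  (\matrix_(k < 3) row_mx (1%:M : 'M_1) (row (tnth [tuple i1; i2; i3] k) p))^T.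

Definition equivalent (S : pure2_complex n) (p q : configuration) : Prop :=
  forall i1 i2 i3 : 'I_n, (i1 < i2 < i3)%N ->
    [set i1; i2; i3]%SET \in two_simplices S ->
    \det (Cmat i1 i2 i3 p) = \det (Cmat i1 i2 i3 q).

Definition congruent (p q : configuration) : Prop :=
  forall i1 i2 i3 : 'I_n, (i1 < i2 < i3)%N ->
    \det (Cmat i1 i2 i3 p) = \det (Cmat i1 i2 i3 q).

Definition congruence_classes (S : pure2_complex n) (p : configuration) :
    set (set configuration) :=
  [set [set q' | equivalent S p q' /\ congruent q q']
     | q in [set q | equivalent S p q]]%classic.

End Frameworks.

Definition alg_independent (R : realType) (m : nat) (x : 'I_m -> R) : Prop :=
  forall f : {mpoly rat[m]},
    (map_mpoly (@ratr R) f).@[x] = 0 -> f = 0.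

Definition generic (R : realType) (n : nat) (p : configuration R n) : Prop :=
  alg_independent (fun k : 'I_(n * 2) => mxvec p 0 k).

(* Main.v *)
Require Import Defs.
From mathcomp Require Import all_boot all_order all_algebra.
From mathcomp Require Import boolp classical_sets functions cardinality reals.
From mathcomp Require Import mpoly zify ring lra.

Set Implicit Arguments.
Unset Strict Implicit.
Unset Printing Implicit Defensive.

Import Order.TTheory GRing.Theory Num.Theory.

Local Open Scope ring_scope.

(** Put apex [1] at the origin and write [E i j] for the signed area of
    [1 i j], [v_0, ..., v_(m-1)] for the equator ([m = n - 2], indices mod [m]),
    [a_j = E v_j v_(j+1)] and [h_j = E v_j n].  If [q] is equivalent to [p], the
    [a_j] and the differences [h_(j+1) - h_j] are prescribed, so all heights are
    [h_j = t - c_j] with [t = h_0] the only unknown.  The Pluecker relation gives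
    [E v_0 v_(j+1) / h_(j+1) - E v_0 v_j / h_j = h_0 a_j / (h_j h_(j+1))], and
    summing around the equator yields [sum_j a_j / (h_j h_(j+1)) = 0].  After
    clearing denominators, [t] is a root of a polynomial of degree at most
    [m - 2 = n - 4], with leading coefficient [sum_j a_j], nonzero by genericity.
    Conversely [t] determines every [E i j], hence the congruence class. *)

(** * Signed areas: identities, determinants and generic nonvanishing *)

Section Area.
Variables (T : comPzRingType) (n : nat).
Implicit Types (g : 'I_n -> 'I_2 -> T) (i j k : 'I_n).

Definition area g i j k : T :=
  (g j 0 - g i 0) * (g k 1 - g i 1) - (g k 0 - g i 0) * (g j 1 - g i 1).

Lemma area_swap g i j k : area g i k j = - area g i j k.
Proof. rewrite /area; ring. Qed.

Lemma area_rot g i j k : area g j k i = area g i j k.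
Proof. rewrite /area; ring. Qed.

Lemma area_base g o i j k :
  area g i j k = area g o i j + area g o j k - area g o i k.
Proof. rewrite /area; ring. Qed.

Lemma area_plucker g o i j k l :
  area g o i j * area g o k l - area g o i k * area g o j l
  + area g o i l * area g o j k = 0.
Proof. rewrite /area; ring. Qed.

End Area.

Lemma rmorph_area (T U : comPzRingType) (f : {rmorphism T -> U}) n
    (g : 'I_n -> 'I_2 -> T) i j k :
  f (area g i j k) = area (fun l c => f (g l c)) i j k.
Proof. by rewrite /area !(rmorphB, rmorphM). Qed.

Lemma det_mx33 (T : comPzRingType) (A : 'M[T]_3) :
  let i1 := lift ord0 ord0 : 'I_3 in let i2 := lift ord0 (lift ord0 ord0) in
  \det A = A ord0 ord0 * (A i1 i1 * A i2 i2 - A i1 i2 * A i2 i1)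
         - A ord0 i1 * (A i1 ord0 * A i2 i2 - A i1 i2 * A i2 ord0)
         + A ord0 i2 * (A i1 ord0 * A i2 i1 - A i1 i1 * A i2 ord0).
Proof.
move=> i1 i2; rewrite (expand_det_row _ ord0) !big_ord_recl big_ord0 addr0.
rewrite /cofactor !(expand_det_row _ ord0) !big_ord_recl !big_ord0 /cofactor.
rewrite !det_mx11 !mxE.
have e1 : lift (lift ord0 ord0 : 'I_2) (ord0 : 'I_1) = ord0 by apply: val_inj.
have e10 : lift (i1 : 'I_3) (ord0 : 'I_2) = ord0 by apply: val_inj.
have e11 : lift (i1 : 'I_3) (lift ord0 ord0 : 'I_2) = i2 by apply: val_inj.
have e20 : lift (i2 : 'I_3) (ord0 : 'I_2) = ord0 by apply: val_inj.
have e21 : lift (i2 : 'I_3) (lift ord0 ord0 : 'I_2) = i1 by apply: val_inj.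
rewrite -/i1 -/i2 !(e1, e11, e21, e10, e20) /=; ring.
Qed.

Lemma det_Cmat (R : realType) n (p : configuration R n) i j k :
  \det (Cmat i j k p) = area p i j k.
Proof.
rewrite /Cmat det_tr; set A := (X in \det X).
have A0 l : A l ord0 = 1.
  have -> : ord0 = lshift 2 ord0 :> 'I_(1 + 2) by apply: val_inj.
  by rewrite mxE row_mxEl mxE.
have A1 l : A l (lift ord0 ord0) = p (tnth [tuple i; j; k] l) 0.
  have -> : lift ord0 ord0 = rshift 1 0 :> 'I_(1 + 2) by apply: val_inj.
  by rewrite mxE row_mxEr mxE.
have A2 l : A l (lift ord0 (lift ord0 ord0)) = p (tnth [tuple i; j; k] l) 1.
  have -> : lift ord0 (lift ord0 ord0) = rshift 1 1 :> 'I_(1 + 2)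
    by apply: val_inj.
  by rewrite mxE row_mxEr mxE.
rewrite det_mx33 !A0 !A1 !A2 /area !(tnth_nth i) /=; ring.
Qed.

(** The sum is a rational polynomial in the coordinates. If it vanished at a generic [p] it would be
    the zero polynomial, hence vanish at [M] too; so one rational witness suffices. *)
Lemma generic_sum_area_neq0 (R : realType) n (p : configuration R n)
    (s : seq ('I_n * 'I_n * 'I_n)) (M : 'M[rat]_(n, 2)) :
  generic p ->
  \sum_(e <- s) area M e.1.1 e.1.2 e.2 != 0 ->
  \sum_(e <- s) area p e.1.1 e.1.2 e.2 != 0.
Proof.
move=> gp; apply: contraNneq => sp0.
pose g (i : 'I_n) (c : 'I_2) : {mpoly rat[n * 2]} := 'X_(mxvec_index i c).
pose f := \sum_(e <- s) area g e.1.1 e.1.2 e.2.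
have evf (T : comPzRingType) (ev : {rmorphism {mpoly rat[n * 2]} -> T}) h :
    (forall i c, ev (g i c) = h i c) ->
    ev f = \sum_(e <- s) area h e.1.1 e.1.2 e.2.
  move=> evg; rewrite rmorph_sum; apply: eq_bigr => e _.
  by rewrite rmorph_area /area !evg.
have f0 : f = 0.
  apply: gp; rewrite -[RHS]sp0.
  apply: (evf R (meval (mxvec p 0) \o map_mpoly (@ratr R))) => i c /=.
  by rewrite map_mpolyX mevalXU mxvecE.
rewrite -(evf _ (meval (mxvec M 0))) => [|i c]; first by rewrite f0 rmorph0.
exact: etrans (mevalXU _ _) (mxvecE _ _ _).
Qed.

Lemma generic_area_neq0 (R : realType) n (p : configuration R n) i j k :
  generic p -> i != j -> i != k -> j != k -> area p i j k != 0.
Proof.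
move=> gp ij ik jk.
(* Vertex [j] goes to (1,0), [k] to (0,1) and all others, [i] included, to the origin: the area is
   1. *)
pose M : 'M[rat]_(n, 2) :=
  \matrix_(l, c) ((l == j) && (c == 0) || (l == k) && (c == 1))%:R.
have := @generic_sum_area_neq0 R n p [:: (i, j, k)] M gp.
rewrite !big_seq1 /=; apply.
by rewrite /area !mxE !eqxx (eq_sym k j) (negPf ij) (negPf ik) (negPf jk).
Qed.

(** Linear factors are split off one at a time. Since [size] is the degree plus one, the strict
    bound says that the list is no longer than the degree. *)
Lemma poly_roots_seq (F : fieldType) (P : {poly F}) : P != 0 ->
  exists2 s : seq F, (size s < size P)%N & forall x, root P x -> x \in s.
Proof.
elim: {P}(size P) {-2}P (leqnn (size P)) => [|d IHd] P sP P0.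
  by rewrite leqn0 size_poly_eq0 (negPf P0) in sP.
have [[x rx]|nr] := pselect (exists x, root P x); last first.
  exists [::] => [|x rx]; first by rewrite size_poly_gt0.
  by case: nr; exists x.
have /factor_theorem [Q PE] := rx.
have Q0 : Q != 0 by apply: contraNneq P0 => Q0; rewrite PE Q0 mul0r.
have szP : size P = (size Q).+1.
  by rewrite PE size_Mmonic ?monicXsubC // size_XsubC addn2.
have [|s sQ hs] := IHd Q _ Q0; first by rewrite -ltnS -szP.
exists (x :: s) => [|y]; first by rewrite szP ltnS.
rewrite PE rootM root_XsubC inE => /orP[/hs ->|->] //.
by rewrite orbT.
Qed.

(** * The numerator of a cyclic sum of fractions *)

Section CyclicPoly.
Variables (F : fieldType) (m : nat) (a c : 'I_m -> F).
Hypothesis m_gt1 : (1 < m)%N.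

(** What is left of the common denominator, the product of all ['X - c k], after division by the two
    factors at [j] and its cyclic successor. *)
Definition cyclic_factor (j : 'I_m) : {poly F} :=
  \prod_(k <- enum (~: [set j; ordS j])%SET) ('X - (c k)%:P).

Definition cyclic_poly : {poly F} := \sum_j a j *: cyclic_factor j.

Lemma ordS_neq (j : 'I_m) : ordS j != j.
Proof.
rewrite -val_eqE /=; have := ltn_ord j; rewrite leq_eqVlt => /orP[/eqP jm|jm].
  by rewrite jm modnn; lia.
by rewrite modn_small //; lia.
Qed.

Lemma size_cyclic_factor j : size (cyclic_factor j) = m.-1.
Proof.
rewrite size_prod_XsubC -cardE.
have := cardsC [set j; ordS j]%SET; rewrite cards2 eq_sym ordS_neq card_ord.
by move: #|_| => d; lia.
Qed.

Lemma size_cyclic_poly : (size cyclic_poly <= m.-1)%N.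
Proof.
apply: (big_ind (fun P : {poly F} => size P <= m.-1)%N) => [|P Q sP sQ|j _].
- by rewrite size_poly0.
- by rewrite (leq_trans (size_polyD P Q)) // geq_max sP.
by rewrite (leq_trans (size_scale_leq _ _)) // size_cyclic_factor.
Qed.

(** Every [cyclic_factor] is monic of degree [m - 2], so the coefficient in that degree is the sum
    of the [a j]. *)
Lemma cyclic_poly_neq0 : \sum_j a j != 0 -> cyclic_poly != 0.
Proof.
apply: contraNneq => P0.
apply/eqP; rewrite -[RHS](coef0 F m.-2) -P0 coef_sum.
apply: eq_bigr => j _.
have : cyclic_factor j \is monic by apply: monic_prod_XsubC.
by rewrite monicE lead_coefE size_cyclic_factor coefZ => /eqP ->; rewrite mulr1.
Qed.

Lemma horner_cyclic_poly (t : F) : (forall j, t - c j != 0) ->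
  cyclic_poly.[t] =
  (\prod_j (t - c j)) * \sum_j a j / ((t - c j) * (t - c (ordS j))).
Proof.
move=> tc; rewrite /cyclic_poly horner_sum mulr_sumr; apply: eq_bigr => j _.
rewrite hornerZ horner_prod big_enum /=.
rewrite [in RHS](bigD1 j) //= [in RHS](bigD1 (ordS j)) ?ordS_neq //=.
under eq_bigr do rewrite hornerXsubC.
rewrite (eq_bigl (fun k => (k != j) && (k != ordS j))); last first.
  by move=> k; rewrite !inE negb_or.
move: (\prod_(_ | _) _) => z; field.
by rewrite !tc.
Qed.

End CyclicPoly.


(** * Cyclic indexing of the equator *)

Section Bipyramid.
Variables (R : realType) (m : nat).
Hypothesis m_gt2 : (2 < m)%N.
Local Notation n := m.+2.
Implicit Types (p q : configuration R n).

(** Defined on all naturals, so that inductions can run once around the equator. The shift by one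
    skips the apex [ord0]; the other apex is [ord_max]. *)
Definition equator (j : nat) : 'I_n := inord (j %% m).+1.

Lemma equator_val j : equator j = (j %% m).+1 :> nat.
Proof. by rewrite inordK // !ltnS ltnW // ltn_pmod //; lia. Qed.

Lemma equator_mod j : equator (j %% m) = equator j.
Proof. by rewrite /equator modn_mod. Qed.

Lemma equatorD j : equator (j + m) = equator j.
Proof. by rewrite /equator modnDr. Qed.

Lemma equatorS_val j : 
  equator j.+1 = (if (j %% m).+1 == m then 1 else (j %% m).+2)%N :> nat.
Proof.
rewrite equator_val -[j.+1]addn1 -modnDml addn1.
have : (j %% m < m)%N by apply: ltn_pmod; lia.
rewrite leq_eqVlt; case: eqP => [->|_ /= h]; first by rewrite modnn.
by rewrite modn_small.
Qed.

Lemma equator_neq j : [/\ equator j != equator j.+1,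
  equator j != equator j.+2 & equator j.+1 != equator j.+2].
Proof.
have jm : (j %% m < m)%N by apply: ltn_pmod; lia.
have sm := equatorS_val j; rewrite equator_val in sm.
have := equatorS_val j.+1; have := equatorS_val j.
have := equator_val j; rewrite -!val_eqE /= => -> -> ->.
by move: sm; case: ifP => /eqP ? ?; case: ifP => /eqP ?; split; lia.
Qed.

Lemma equator_neq_apex j : equator j != ord0 /\ equator j != ord_max.
Proof.
have jm : (j %% m < m)%N by apply: ltn_pmod; lia.
by rewrite -!val_eqE /= equator_val; lia.
Qed.

Lemma equatorP (i : 'I_n) :
  [\/ i = ord0, i = ord_max | exists j, i = equator j].
Proof.
have := ltn_ord i; case: (eqVneq (i : nat) 0%N) => [i0 _|i0 im].
  by constructor 1; apply: val_inj.
case: (eqVneq (i : nat) m.+1) => [i1|i1].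
  by constructor 2; apply: val_inj.
constructor 3; exists i.-1; apply: val_inj.
rewrite /= equator_val modn_small; lia.
Qed.

(** * Areas prescribed by equivalence *)

Section Equivalence.
Variables (S : pure2_complex n).
Hypothesis hS : is_bipyramid S.

Lemma labelledE (i j k : 'I_n) :
  labelled n [:: i.+1; j.+1; k.+1] = [set i; j; k]%SET.
Proof. by apply/setP => v; rewrite !inE !eqSS !val_eqE orbA. Qed.

Lemma equivalent_area p q (i j k : 'I_n) : equivalent S p q ->
  (i < j < k)%N -> [:: i.+1; j.+1; k.+1] \in bipyramid_triples n ->
  area p i j k = area q i j k.
Proof.
move=> pq ijk hT; rewrite -!det_Cmat; apply: pq => //.
by rewrite hS inE -labelledE map_f.
Qed.

Lemma bipyramid_triples_mem (j : nat) : (2 <= j < n.-1)%N ->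
  [:: 1%N; j; j.+1] \in bipyramid_triples n /\
  [:: j; j.+1; n] \in bipyramid_triples n.
Proof.
move=> hj; rewrite /bipyramid_triples !mem_cat; split.
  by rewrite (map_f (fun i => [:: 1%N; i; i.+1])) // mem_index_iota.
rewrite orbC (map_f (fun i => [:: i; i.+1; n])) // mem_index_iota //.
Qed.

Lemma equivalent_lower p q j : equivalent S p q ->
  area p ord0 (equator j) (equator j.+1) =
  area q ord0 (equator j) (equator j.+1).
Proof.
move=> pq; have jm : (j %% m < m)%N by apply: ltn_pmod; lia.
have := equatorS_val j; have := equator_val j; case: ifP => /eqP jE vj vj1.
  (* The edge closing the equator runs from label n-1 back to label 2; the face is listed in
     increasing order, which costs a sign. *)
  rewrite area_swap [RHS]area_swap; congr (- _).
  apply: (equivalent_area pq); rewrite vj vj1 ?jE /=; first by lia.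
  by rewrite /bipyramid_triples !mem_cat !inE eqxx !orbT.
apply: (equivalent_area pq); rewrite vj vj1 /=; first by lia.
by have [] := @bipyramid_triples_mem (j %% m).+2; first lia.
Qed.

Lemma equivalent_upper p q j : equivalent S p q ->
  area p (equator j) (equator j.+1) ord_max =
  area q (equator j) (equator j.+1) ord_max.
Proof.
move=> pq; have jm : (j %% m < m)%N by apply: ltn_pmod; lia.
have := equatorS_val j; have := equator_val j; case: ifP => /eqP jE vj vj1.
  rewrite -area_rot area_swap -[RHS]area_rot [RHS]area_swap; congr (- _).
  apply: (equivalent_area pq); rewrite vj vj1 ?jE /=; first by lia.
  by rewrite /bipyramid_triples !mem_cat !inE eqxx !orbT.
apply: (equivalent_area pq); rewrite vj vj1 /=; first by lia.
by have [] := @bipyramid_triples_mem (j %% m).+2; first lia.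
Qed.

(** * Heights and the relation around the equator *)

Definition height p j : R := area p ord0 (equator j) ord_max.

Lemma equivalent_heightB p q j : equivalent S p q ->
  height q j - height p j = height q 0 - height p 0.
Proof.
move=> pq; elim: j => // j <-.
have := equivalent_upper j pq; have := equivalent_lower j pq.
rewrite !(area_base _ ord0 (equator j)) /height => -> e.
by lra.
Qed.


Lemma equivalent_height_neq0 p q j :
  generic p -> equivalent S p q -> height q j != 0.
Proof.
(* Going once around makes the index a successor, so that both neighbours of the vertex can be
   named. *)
move=> gp pq; have -> : height q j = height q (j + m.-1).+1.
  by rewrite /height -addnS prednK ?equatorD //; lia.
move: (j + m.-1)%N => {}j; apply/eqP => hq1.
(* If [h_(j+1)] vanished at [q], the Pluecker relations at [q] and [p] would make
   the product of two areas at [p], of [v_j v_(j+1) v_(j+2)] and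
   [1 v_(j+1) n], vanish. *)
have [n01 n02 n12] := equator_neq j.
have [n1o n1m] := equator_neq_apex j.+1.
have : height p j.+1 != 0 by apply: generic_area_neq0; rewrite // eq_sym.
have := generic_area_neq0 gp n01 n02 n12.
rewrite (area_base _ ord0) => A0 h0; case/negP: (mulf_neq0 A0 h0); apply/eqP.
have := area_plucker q ord0 (equator j) (equator j.+1) (equator j.+2) ord_max.
have := area_plucker p ord0 (equator j) (equator j.+1) (equator j.+2) ord_max.
have := equivalent_heightB j pq; have := equivalent_heightB j.+2 pq.
rewrite -(equivalent_heightB j.+1 pq) hq1 -!(equivalent_lower _ pq).
rewrite -!/(height _ _) hq1 => /eqP; rewrite subr_eq => /eqP ->.
move=> /eqP; rewrite subr_eq => /eqP -> ep eq.
by lra.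
Qed.

Definition spoke q j : R := area q ord0 (equator 0) (equator j).

Definition slope q j : R :=
  area q ord0 (equator j) (equator j.+1) / (height q j * height q j.+1).

(** The telescoped Pluecker relation, multiplied out. No bound on [j] is imposed, so it also applies
    at [j = m], where the equator closes. *)
Lemma spoke_slope q j : (forall k, height q k != 0) ->
  spoke q j = height q 0 * height q j * \sum_(k < j) slope q k.
Proof.
move=> h0; elim: j => [|j IHj].
  by rewrite big_ord0 /spoke /area; ring.
apply: (mulIf (h0 j)); rewrite big_ord_recr /=.
have /eqP := area_plucker q ord0 (equator 0) (equator j) (equator j.+1) ord_max.
rewrite -!/(spoke _ _) -!/(height _ _) addrAC subr_eq add0r => /eqP <-.
rewrite IHj /slope; field.
by rewrite !h0.
Qed.

(** * The polynomial constraining the height of the first equatorial vertex *)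

Definition height_poly p : {poly R} :=
  cyclic_poly (fun j : 'I_m => area p ord0 (equator j) (equator j.+1))
              (fun j : 'I_m => height p 0 - height p j).

Lemma size_height_poly p : (size (height_poly p) <= m.-1)%N.
Proof. by apply: size_cyclic_poly; lia. Qed.

Lemma height_poly_neq0 p : generic p -> height_poly p != 0.
Proof.
move=> gp; apply: cyclic_poly_neq0; first by lia.
(* With v_0 at (1,0), v_1 at (0,1) and the rest at the origin, only the term [j = 0] survives, with
   value 1; the term [j = 1] vanishes because v_2 differs from v_0. *)
pose M : 'M[rat]_(n, 2) :=
  \matrix_(l, c) ((l == equator 0) && (c == 0)
                || (l == equator 1) && (c == 1))%:R.
have := @generic_sum_area_neq0 R n p
  [seq (ord0, equator j, equator j.+1) | j : 'I_m] M gp.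
rewrite !big_image /=; apply.
have m0 : (0 < m)%N by lia.
have eq_equator (j : 'I_m) k : (k < m)%N ->
    (equator j == equator k) = (j == k :> nat).
  by move=> km; rewrite -val_eqE /= !equator_val !modn_small.
have eq_apex j : (ord0 == equator j) = false.
  by have [h _] := equator_neq_apex j; rewrite eq_sym (negPf h).
have [n01 n02 n12] := equator_neq 0.
rewrite (bigD1 (Ordinal m0)) //= big1 => [|j j0].
  by rewrite addr0 /area !mxE !eqxx !eq_apex (eq_sym (equator 1)) (negPf n01).
rewrite /area !mxE !eq_apex !eq_equator ?(ltnW m_gt2) //.
rewrite -val_eqE /= in j0; rewrite (negPf j0) /=.
have [->|_] := eqVneq (j : nat) 1%N; last by rewrite /= !andbF; ring.
by rewrite (eq_sym (equator 2)) (negPf n02) !andbF /=; ring.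
Qed.

Lemma root_height_poly p q : generic p -> equivalent S p q ->
  root (height_poly p) (height q 0).
Proof.
move=> gp pq; have h0 j := equivalent_height_neq0 j gp pq.
have hE j : height q 0 - (height p 0 - height p j) = height q j.
  by have := equivalent_heightB j pq; lra.
rewrite /root horner_cyclic_poly => [||j]; [|lia|by rewrite hE].
(* After a full turn the spoke is the area of a triangle with v_0 repeated, hence zero; cancelling
   the nonzero heights leaves a zero sum of slopes. *)
have := spoke_slope m h0.
have -> : spoke q m = 0.
  by rewrite /spoke /equator modnn mod0n /area; ring.
move/esym/eqP; rewrite !mulf_eq0 !(negPf (h0 _)) /= => /eqP s0.
apply/orP; right; apply/eqP; rewrite -[RHS]s0; apply: eq_bigr => j _.
by rewrite !hE (equivalent_lower _ pq) /slope {2}/height equator_mod.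
Qed.

(** * Congruence classes as fibres of the height *)

Lemma equivalent_congruent p q q' : generic p -> equivalent S p q ->
  equivalent S p q' -> height q 0 = height q' 0 -> congruent q q'.
Proof.
move=> gp pq pq' hqq' i j k _; rewrite !det_Cmat.
have h0 l := equivalent_height_neq0 l gp pq.
have h0' l := equivalent_height_neq0 l gp pq'.
have hE l : height q l = height q' l.
  have := equivalent_heightB l pq; have := equivalent_heightB l pq'.
  by rewrite hqq'; lra.
have sE l : spoke q l = spoke q' l.
  rewrite !spoke_slope // !hE; congr (_ * _); apply: eq_bigr => a _.
  by rewrite /slope !hE -!(equivalent_lower _ pq, equivalent_lower _ pq').
have vE (l : 'I_n) : area q ord0 l ord_max = area q' ord0 l ord_max /\
    area q ord0 (equator 0) l = area q' ord0 (equator 0) l.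
  case: (equatorP l) => [->|->|[b ->]]; last by split; [exact: hE|exact: sE].
    by split; rewrite /area; ring.
  by split; last exact: hE; rewrite /area; ring.
(* In the Pluecker relation for v_0, [a], [b] and [ord_max], this area is multiplied by
   [height q 0], which is nonzero, and all other areas are known from [vE]. *)
have EE (a b : 'I_n) : area q ord0 a b = area q' ord0 a b.
  have := area_plucker q ord0 (equator 0) a b ord_max.
  have := area_plucker q' ord0 (equator 0) a b ord_max.
  have [-> ->] := vE a; have [-> ->] := vE b; rewrite -!/(height _ _) hE => <-.
  by move/addrI/(mulfI (h0' 0%N)).
by rewrite !(area_base _ ord0 i) !EE.
Qed.

Lemma congruent_height q q' : congruent q q' -> height q 0 = height q' 0.
Proof.
move=> qq'; rewrite /height -!det_Cmat; apply: qq'.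
by rewrite equator_val mod0n /=; lia.
Qed.

Lemma card_congruence_classes p : generic p ->
  (congruence_classes S p #<= `I_(m - 2)%N)%card.
Proof.
move=> gp; have [s ss hs] := poly_roots_seq (height_poly_neq0 gp).
(* One fibre per listed root. Indices past the end of [s] read the default 0, which is harmless:
   only a covering of the classes is needed. *)
pose C (k : nat) : set (configuration R n) :=
  [set q | equivalent S p q /\ height q 0 = s`_k]%classic.
have sub : (congruence_classes S p `<=` C @` `I_(m - 2))%classic.
  move=> _ [q /= pq <-].
  have hq := hs _ (root_height_poly gp pq).
  exists (index (height q 0) s).
    (* The root list is strictly shorter than [size (height_poly p)], itself at most [m - 1]; hence
       at most [m - 2] roots. *)
    rewrite /= (leq_trans (_ : _ < size s)%N) ?index_mem //.
    by move: (leq_trans ss (size_height_poly p)); lia.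
  apply/seteqP; split=> q' /= [pq' H]; split => //.
    by apply: (equivalent_congruent gp) => //; rewrite H nth_index.
  by rewrite nth_index //; apply/esym/congruent_height.
exact: card_le_trans (subset_card_le sub) (card_image_le _ _).
Qed.

End Equivalence.
End Bipyramid.

Local Open Scope classical_set_scope.
Local Open Scope card_scope.

Theorem theorem1p2 (R : realType) (n : nat) (hn : (5 <= n)%N)
  (S : pure2_complex n) (hS : is_bipyramid S)
  (p : configuration R n) (hp : generic p) :
  congruence_classes S p #<= `I_(n - 4)%N.
Proof.
case: n hn S hS p hp => [|[|m]] // hm S hS p gp.
have -> : (m.+2 - 4 = m - 2)%N by lia.
exact: card_congruence_classes.
Qed.
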